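(* Let $A$ be a BP*-algebra and let $M_{s}(A)$ be the set of all nonzero hermitian multiplicative linear functionals on $A$. If $M_{s}(A)$ is equicontinuous, then every positive linear functional on $A$ is continuous.
   Context: A topological algebra is an algebra over $\mathbb{C}$ which is also a Hausdorff topological vector space such that the multiplication is separately continuous; a locally convex algebra is a topological algebra whose topology is locally convex. Let $A$ be a commutative locally convex algebra with identity $e$ and with a continuous involution $x\mapsto x^{\ast}$. Let $\beta$ be the family of all subsets $B\subset A$ that are closed, bounded, absolutely convex, contain $e$, hermitian ($B^{\ast}=B$) and idempotent ($BB\subset B$). For $B\in\beta$, let $A_{B}$ be the linear span of $B$, a *-subalgebra of $A$ which is a normed *-algebra with identity and isometric involution when equipped with the Minkowski functional $\Vert\cdot\Vert_{B}$ of $B$. $A$ is called a BP*-algebra if $A=\bigcup\{A_{B}: B\in\beta\}$ and $(A_{B},\Vert\cdot\Vert_{B})$ is complete for every $B\in\beta$. A linear functional $f:A\to\mathbb{C}$ (not assumed continuous) is positive if $f(x^{\ast}x)\geq 0$ for all $x\in A$, hermitian if $f(x^{\ast})=\overline{f(x)}$ for all $x\in A$, and multiplicative if $f(xy)=f(x)f(y)$ for all $x,y\in A$. *)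

(* Defs.v *)
From HB Require Import structures.
From mathcomp Require Import all_boot all_order all_algebra.
From mathcomp Require Import complex.
From mathcomp Require Import all_classical all_reals all_analysis.

Set Implicit Arguments.
Unset Strict Implicit.
Unset Printing Implicit Defensive.

Import Order.TTheory GRing.Theory Num.Theory.
Import numFieldNormedType.Exports.

Local Open Scope classical_set_scope.
Local Open Scope ring_scope.
Local Open Scope complex_scope.

(* Local convexity is part of Tvs.  The uniformity packaged in Tvs need not be
   the translation-invariant one, so only the topology of A is used below.
   Continuity in the other factor follows from commutativity. *)
HB.mixin Record isLocallyConvexComAlgebra (K : numFieldType) A
    of Tvs K A & GRing.ComAlgebra K A := {
  lca_mul_continuous : forall y : A, continuous (fun x : A => x * y) ;
  lca_hausdorff : hausdorff_space A
}.

#[short(type="locallyConvexComAlgType")]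
HB.structure Definition LocallyConvexComAlgebra (K : numFieldType) :=
  {A of isLocallyConvexComAlgebra K A & Tvs K A & GRing.ComAlgebra K A}.

Section BPstarAlgebra.
Context {R : realType} {A : locallyConvexComAlgType R[i]}.
Implicit Types (star : A -> A) (B U : set A) (x y : A).

Record is_involution star : Prop := {
  starD : forall x y, star (x + y) = star x + star y ;
  starZ : forall (a : R[i]) x, star (a *: x) = a^* *: star x ;
  starM : forall x y, star (x * y) = star y * star x ;
  starK : involutive star
}.

Definition tvs_bounded B :=
  forall U, nbhs (0 : A) U ->
    exists2 r : R, 0 < r & B `<=` [set r%:C *: x | x in U].

Definition absolutely_convex B :=
  forall (a b : R[i]) x y, `|a| + `|b| <= 1 -> B x -> B y -> B (a *: x + b *: y).

Record bpstar_family star B : Prop := {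
  bpf_closed : closed B ;
  bpf_bounded : tvs_bounded B ;
  bpf_absconvex : absolutely_convex B ;
  bpf_one : B 1 ;
  bpf_hermitian : star @` B = B ;
  bpf_idempotent : forall x y, B x -> B y -> B (x * y)
}.

Definition lin_span B : set A :=
  [set x | exists (n : nat) (a : 'I_n -> R[i]) (v : 'I_n -> A),
     (forall i, B (v i)) /\ x = \sum_(i < n) a i *: v i].

(* Outside lin_span B the set is empty and inf gives the junk value 0. *)
Definition minkowski_functional B x : R :=
  inf [set r : R | 0 < r /\ exists2 y, B y & x = r%:C *: y].

(* For B in bpstar_family, lin_span B is normed by minkowski_functional B, so
   completeness is stated with Cauchy sequences. *)
Definition span_complete B :=
  forall u : nat -> A, (forall n, lin_span B (u n)) ->
    (forall eps : R, 0 < eps -> exists N : nat, forall m n : nat,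
       (N <= m)%N -> (N <= n)%N -> minkowski_functional B (u m - u n) < eps) ->
    exists2 l, lin_span B l &
      (fun n => minkowski_functional B (u n - l)) @ \oo --> (0 : R).

Record is_BPstar_algebra star : Prop := {
  bps_involution : is_involution star ;
  bps_continuous : continuous star ;
  bps_cover : \bigcup_(B in bpstar_family star) lin_span B = [set: A] ;
  bps_complete : forall B, bpstar_family star B -> span_complete B
}.

Implicit Types f : {scalar A}.

Definition positive_functional star f := forall x, 0 <= f (star x * x).

Definition hermitian_functional star f := forall x, f (star x) = (f x)^*.

Definition multiplicative_functional f := forall x y, f (x * y) = f x * f y.

Definition Ms star : set {scalar A} :=
  [set f : {scalar A} | [/\ exists x : A, f x != 0, hermitian_functional star f
             & multiplicative_functional f]].

End BPstarAlgebra.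

(* Main.v *)
From HB Require Import structures.
Require Import Defs.
From mathcomp Require Import all_boot all_order all_algebra.
From mathcomp Require Import complex ring lra.
From mathcomp Require Import all_classical all_reals all_analysis.

Set Implicit Arguments.
Unset Strict Implicit.
Unset Printing Implicit Defensive.

Import Order.TTheory GRing.Theory Num.Theory.
Import numFieldNormedType.Exports.
Local Open Scope classical_set_scope.
Local Open Scope ring_scope.
Local Open Scope complex_scope.

(** A positive functional f on A is controlled by the hermitian characters: if
    every phi in [Ms] has |phi x| <= r then |f x| <= 2 f(1) r
    ([positive_functional_le]).  Applied to differences x - y, this turns the
    equicontinuity of [Ms] into the continuity of f.

    To get the bound, work with the states, i.e. the positive functionals G with
    G 1 = 1, among which is f / f(1) when f is nonzero.  Completeness of the algebras A_B
    enters once: if h is hermitian and small in A_B, then 1 - h is the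
    square of a hermitian element ([exists_sqrt_one_sub]).  Hence on every
    element all states obey a common bound ([real_state_bounded]), although
    none of them is known to be continuous, and by Tychonoff's theorem the
    states form a compact set for pointwise convergence.

    A character is then found inside this compact set.  Each state G can be
    tilted by b into y |-> G(b^* b y) / G(b^* b).  If G maximizes the value at
    a = x^* x over a set of states stable under tilting, comparing G with its
    tilt by x gives G(a^2) <= G(a)^2, so a - G(a) is a null vector of G and the
    Cauchy-Schwarz inequality gives G(a y) = G(a) G(y) for all y
    ([tilt_maximum_multiplicative]).  The maximizers are again compact and
    stable under tilting, so finitely many elements x can be treated in turn,
    and by compactness all of them at once.  Starting the process with a given
    x yields a character phi with |phi x|^2 at least the value at x^* x of the
    state one started from ([exists_multiplicative_state],
    [exists_character]); Cauchy-Schwarz for f finishes the proof.  The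
    maximization takes the place that the Krein-Milman theorem has in the
    usual argument. *)

(** * Scalars, discriminants and closed conditions *)

Lemma conjC_real {R : realType} (r : R) : (r%:C : R[i])^*%R = r%:C.
Proof. by rewrite [LHS]conjc_real. Qed.

Lemma conjC_i {R : realType} : ('i : R[i])^*%R = - 'i.
Proof. by apply/eqP; rewrite eq_complex /= oppr0 !eqxx. Qed.

Lemma normC_real {R : realType} (r : R) : 0 <= r -> `|r%:C : R[i]| = r%:C.
Proof. by move=> r0; rewrite ger0_norm // lecR. Qed.

Lemma discriminant_le {R : realType} (p q s : R) : 0 <= s ->
  (forall t, 0 <= p + t * q *+ 2 + t ^+ 2 * s) -> q ^+ 2 <= p * s.
Proof.
rewrite le0r => /predU1P[s0|s0] H.
- have [->|q0] := eqVneq q 0; first by rewrite expr0n /= s0 mulr0.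
  have := H (- (p + 1) / (q *+ 2)).
  have -> : p + - (p + 1) / (q *+ 2) * q *+ 2 + (- (p + 1) / (q *+ 2)) ^+ 2 * s = -1.
    by rewrite s0; field; rewrite q0.
  by rewrite ler0N1.
- have := H (- q / s).
  have -> : p + (- q / s) * q *+ 2 + (- q / s) ^+ 2 * s = (p * s - q ^+ 2) / s.
    by field; rewrite gt_eqF.
  by rewrite pmulr_lge0 ?invr_gt0 // subr_ge0.
Qed.

Lemma closed_eq_fun {R : realType} (T : topologicalType) (u v : T -> R) :
  continuous u -> continuous v -> closed [set a | u a = v a].
Proof.
move=> cu cv; have -> : [set a | u a = v a] = (u \- v) @^-1` [set 0].
  by apply/seteqP; split=> t /= => [->|/eqP]; rewrite ?subrr // subr_eq0 => /eqP.
apply: preimage_closed => [t _|]; last exact: closed_eq.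
by apply: cvgB; [exact: cu|exact: cv].
Qed.

Lemma continuous_add {R : realType} (T : topologicalType) (u v : T -> R) :
  continuous u -> continuous v -> continuous (fun a => u a + v a).
Proof. by move=> cu cv a; exact: cvgD (cu a) (cv a). Qed.

Lemma continuous_mul {R : realType} (T : topologicalType) (u v : T -> R) :
  continuous u -> continuous v -> continuous (fun a => u a * v a).
Proof. by move=> cu cv a; exact: cvgM (cu a) (cv a). Qed.

Lemma closed_forall (T : topologicalType) I (P : I -> set T) :
  (forall i, closed (P i)) -> closed [set t | forall i, P i t].
Proof.
move=> Pc; have -> : [set t | forall i, P i t] = \bigcap_(i in setT) P i.
  by apply/seteqP; split=> t H i //; apply: H.
exact: closed_bigI.
Qed.

(** * The involution *)

Section Involution.
Context {R : realType} {A : locallyConvexComAlgType R[i]}.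
Context {star : A -> A} (Hs : is_involution star).
Implicit Types x y : A.

Lemma star1 : star 1 = 1.
Proof.
rewrite -{1}(starK Hs 1) -{1}[star 1]mul1r (starM Hs) (starK Hs).
by rewrite mul1r (starK Hs).
Qed.

Lemma starN x : star (- x) = - star x.
Proof. by rewrite -scaleN1r (starZ Hs) rmorphN1 scaleN1r. Qed.

Lemma starB x y : star (x - y) = star x - star y.
Proof. by rewrite (starD Hs) starN. Qed.

Lemma star0 : star 0 = 0.
Proof. by rewrite -{1}(subrr 1) starB subrr. Qed.

End Involution.

(** * The gauge of a set of the family *)

Section Dilate.
Context {R : realType} {A : locallyConvexComAlgType R[i]}.
Context {star : A -> A} (Hs : is_involution star).
Context {B : set A} (HB : bpstar_family star B).
Implicit Types (x y : A) (r s e : R).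

(** For r > 0 and B in the family, this is the closed ball of radius r of the gauge
    of B.  Algebra with such balls avoids handling the gauge itself, which is an
    infimum. *)
Definition dilate (C : set A) r : set A := [set r%:C *: y | y in C].

Lemma absolutely_convex_scale (a : R[i]) y : `|a| <= 1 -> B y -> B (a *: y).
Proof.
move=> a1 By; have := @bpf_absconvex _ _ _ _ HB a 0 y y.
by rewrite scale0r addr0 normr0 addr0; apply.
Qed.

Lemma dilate_scale (a : R[i]) r s x :
  0 < s -> `|a| * r%:C <= s%:C -> 0 <= r -> dilate B r x -> dilate B s (a *: x).
Proof.
move=> s0 ars r0 [y By <-].
have s0' : s%:C != 0 by rewrite (inj_eq (@complexI _)) gt_eqF.
exists ((s%:C^-1 * (a * r%:C)) *: y); last first.
  by rewrite !scalerA mulrA divff // mul1r.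
apply: absolutely_convex_scale => //.
rewrite normrM normfV normrM (normC_real (ltW s0)) (normC_real r0) mulrC.
by rewrite ler_pdivrMr ?mul1r // ltcR.
Qed.

Lemma dilate_le r s x : 0 < s -> 0 <= r -> r <= s -> dilate B r x -> dilate B s x.
Proof.
move=> s0 r0 rs Bx; rewrite -[x]scale1r.
by apply: dilate_scale Bx => //; rewrite normr1 mul1r lecR.
Qed.

Lemma dilateD r s x y : 0 < r -> 0 < s ->
  dilate B r x -> dilate B s y -> dilate B (r + s) (x + y).
Proof.
move=> r0 s0 [x' Bx <-] [y' By <-].
have t0 : 0 < r + s by rewrite addr_gt0.
have t0' : (r + s)%:C != 0 by rewrite (inj_eq (@complexI _)) gt_eqF.
have E : forall q, (r + s)%:C * (q / (r + s))%:C = q%:C.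
  by move=> q; rewrite -rmorphM mulrC divfK // gt_eqF.
exists ((r / (r + s))%:C *: x' + (s / (r + s))%:C *: y'); last first.
  by rewrite scalerDr !scalerA !E.
apply: (bpf_absconvex HB) => //.
rewrite !normC_real ?divr_ge0 // ?(ltW r0) ?(ltW s0) ?(ltW t0) //.
by rewrite -rmorphD /= -mulrDl divff // gt_eqF.
Qed.

Lemma dilateN r x : dilate B r x -> dilate B r (- x).
Proof.
move=> [y By <-]; exists (- y); last by rewrite scalerN.
by rewrite -scaleN1r; apply: absolutely_convex_scale => //; rewrite normrN1.
Qed.

Lemma dilateM r s x y : dilate B r x -> dilate B s y -> dilate B (r * s) (x * y).
Proof.
move=> [x' Bx <-] [y' By <-]; exists (x' * y'); first exact: (bpf_idempotent HB).
by rewrite -scalerAl -scalerAr scalerA rmorphM.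
Qed.

Lemma dilate_star r x : dilate B r x -> dilate B r (star x).
Proof.
move=> [y By <-]; exists (star y).
  by rewrite -(bpf_hermitian HB); exists y.
by rewrite (starZ Hs) conjC_real.
Qed.

Lemma dilate0 r : dilate B r 0.
Proof.
exists 0; last by rewrite scaler0.
by rewrite -(scale0r 1); apply: absolutely_convex_scale (bpf_one HB); rewrite normr0.
Qed.

Lemma dilate_lin_span r x : dilate B r x -> lin_span B x.
Proof.
move=> [y By <-]; exists 1%N, (fun=> r%:C), (fun=> y); split=> //.
by rewrite big_ord1.
Qed.

Lemma lin_span_dilate x : lin_span B x -> exists2 r, 0 < r & dilate B r x.
Proof.
move=> [n [a [v [Bv ->]]]]; elim/big_rec: _ => [|i y _ [r r0 Hy]].
  by exists 1 => //; exact: dilate0.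
have [b b0 ab] : exists2 b : R, 0 < b & `|a i| <= b%:C.
  exists (Num.sqrt (complex.Re (a i) ^+ 2 + complex.Im (a i) ^+ 2) + 1).
    by rewrite ltr_wpDl // sqrtr_ge0.
  by rewrite normc_def lecR lerDl.
exists (b + r); first by rewrite addr_gt0.
apply: dilateD => //; apply: (@dilate_scale _ 1) => //; first by rewrite mulr1.
by exists (v i) => //; rewrite scale1r.
Qed.

Lemma minkowski_le r x : 0 < r -> dilate B r x -> minkowski_functional B x <= r.
Proof.
move=> r0 [y By <-]; apply: ge_inf; last by split=> //; exists y.
by exists 0 => z [] /ltW.
Qed.

Lemma minkowski_lt_dilate e x :
  lin_span B x -> minkowski_functional B x < e -> dilate B e x.
Proof.
move=> /lin_span_dilate[r r0 [y By yx]] /inf_lt[|s [s0 [z Bz ->]] se].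
  by exists r; split=> //; exists y.
have e0 : 0 < e by exact: lt_trans se.
by apply: (@dilate_le s); rewrite ?ltW //; exists z.
Qed.

(** The balls [dilate B e] get absorbed by every neighbourhood of 0, as [B] is
    bounded, and the topology is Hausdorff: the gauge separates points. *)
Lemma dilate_eq0 x : (forall e, 0 < e -> dilate B e x) -> x = 0.
Proof.
move=> Hx; apply/esym/(@lca_hausdorff _ A) => U V U0 Vx.
exists x; split; last exact: nbhs_singleton.
have [r r0 BU] := bpf_bounded HB U0.
have [y /BU[u Uu <-] <-] : dilate B r^-1 x by apply: Hx; rewrite invr_gt0.
by rewrite scalerA -rmorphM mulVf ?gt_eqF // scale1r.
Qed.

Lemma dilateB r s x y : 0 < r -> 0 < s ->
  dilate B r x -> dilate B s y -> dilate B (r + s) (x - y).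
Proof. by move=> r0 s0 Bx By; apply: dilateD => //; apply: dilateN. Qed.

Lemma dilate_half r x : dilate B r x -> dilate B (r / 2) ((2^-1)%:C *: x).
Proof. by move=> [y By <-]; exists y => //; rewrite scalerA -rmorphM mulrC. Qed.

End Dilate.

(** * Square roots *)

(** A square root of 1 - h is sought as 1 - u, where u = (h + u^2) / 2.  The right
    hand side halves distances on the ball of radius 1/2, because u^2 - v^2 =
    (u - v)(u + v) and u + v has gauge at most 1. *)
Section SquareRoot.
Context {R : realType} {A : locallyConvexComAlgType R[i]}.
Context {star : A -> A} (Hs : is_involution star).
Context {B : set A} (HB : bpstar_family star B).
Implicit Types (x y : A) (r s e : R).

Context {h : A} (hB : dilate B 2^-1 h) (hstar : star h = h).

Fixpoint sqrt_iter n : A :=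
  if n is n'.+1 then (2^-1)%:C *: (h + sqrt_iter n' * sqrt_iter n') else 0.

Lemma sqrt_iterS n :
  sqrt_iter n.+1 = (2^-1)%:C *: (h + sqrt_iter n * sqrt_iter n).
Proof. by []. Qed.

Lemma sqrt_iter_dilate n : dilate B 2^-1 (sqrt_iter n).
Proof.
elim: n => [|n IH]; first exact: (dilate0 HB).
apply: (@dilate_le _ _ _ _ HB ((2^-1 + 2^-1 * 2^-1) / 2)); [by lra|by lra|by lra|].
rewrite sqrt_iterS; apply: dilate_half; apply: (dilateD HB) => //.
exact: (dilateM HB).
Qed.

Lemma sqrt_iter_star n : star (sqrt_iter n) = sqrt_iter n.
Proof.
elim: n => [|n IH]; first exact: (star0 Hs).
by rewrite sqrt_iterS (starZ Hs) conjC_real (starD Hs) (starM Hs) hstar IH.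
Qed.

Lemma sqrt_iter_cauchy m n : (n <= m)%N ->
  dilate B (2^-1 ^+ n) (sqrt_iter m - sqrt_iter n).
Proof.
elim: n m => [|n IH] [|m] // nm.
- by rewrite subrr; exact: (dilate0 HB).
- rewrite subr0; apply: (@dilate_le _ _ _ _ HB 2^-1); [by lra|by lra|by lra|].
  exact: sqrt_iter_dilate.
rewrite !sqrt_iterS -scalerBr opprD addrACA subrr add0r.
rewrite -!expr2 subr_sqr exprSr; apply: dilate_half; rewrite -[2^-1 ^+ n]mulr1.
apply: (dilateM HB); first exact: IH.
rewrite [1](splitr 1) div1r.
by apply: (dilateD HB) => //; exact: sqrt_iter_dilate.
Qed.

(** The fixed point equation and the hermitian symmetry of the limit are obtained by
    placing the differences in all balls of the gauge, without continuity of the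
    product of A in both variables. *)
Lemma exists_sqrt_one_sub : span_complete B ->
  exists2 y, star y = y & y * y = 1 - h.
Proof.
move=> /(_ sqrt_iter) [n|e e0|l Bl ul].
- exact: (dilate_lin_span (sqrt_iter_dilate n)).
- have [N NP] : exists N, 2^-1 ^+ N < e / 2.
    have : (2^-1 : R) ^+ n @[n --> \oo] --> (0 : R).
      by apply: cvg_expr; rewrite ger0_norm; lra.
    move=> /cvgrPdist_lt/(_ (e / 2)) [|N _ /(_ N (leqnn N))]; first by lra.
    by rewrite sub0r normrN ger0_norm ?exprn_ge0 // => ?; exists N.
  exists N => m n Nm Nn; have -> : sqrt_iter m - sqrt_iter n =
      (sqrt_iter m - sqrt_iter N) - (sqrt_iter n - sqrt_iter N) by ring.
  have p0 : 0 < 2^-1 ^+ N :> R by rewrite exprn_gt0.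
  apply: le_lt_trans (_ : 2^-1 ^+ N + 2^-1 ^+ N < e); last by lra.
  apply: minkowski_le; first by lra.
  by apply: (dilateB HB) => //; exact: sqrt_iter_cauchy.
have ul' e : 0 < e -> exists N, forall n, (N <= n)%N -> dilate B e (sqrt_iter n - l).
  move=> e0; move/cvgrPdist_lt : ul => /(_ e e0)[N _ NP]; exists N => n Nn.
  apply: (minkowski_lt_dilate HB).
    have [r r0 lr] := lin_span_dilate HB Bl.
    by apply: dilate_lin_span; apply: (dilateB HB (r := 2^-1) (s := r)) => //;
      exact: sqrt_iter_dilate.
  apply: le_lt_trans (NP n Nn); rewrite sub0r normrN; exact: ler_norm.
have lstar : star l = l.
  apply/eqP; rewrite -subr_eq0; apply/eqP; apply: (dilate_eq0 HB) => e e0.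
  have [|N /(_ N (leqnn _)) NP] := ul' (e / 2); first by lra.
  have -> : star l - l = (sqrt_iter N - l) - star (sqrt_iter N - l).
    by rewrite (starB Hs) sqrt_iter_star; ring.
  rewrite [e]splitr; apply: (dilateB HB); [lra|lra|done|exact: (dilate_star Hs HB)].
have l1 : dilate B 1 l.
  have [|N /(_ N (leqnn _)) NP] := ul' (2^-1); first by lra.
  have -> : l = sqrt_iter N - (sqrt_iter N - l) by ring.
  by rewrite [1](splitr 1) div1r; apply: (dilateB HB) => //; exact: sqrt_iter_dilate.
have lfix : h + l * l - (l + l) = 0.
  apply: (dilate_eq0 HB) => e e0.
  have [|N NP] := ul' (e / 4); first by lra.
  pose u := sqrt_iter N; pose v := sqrt_iter N.+1.
  have uv : h = v + v - u * u.
    rewrite /v sqrt_iterS -scalerDl -rmorphD /=.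
    have -> : 2^-1 + 2^-1 = 1 :> R by lra.
    by rewrite scale1r addrK.
  have -> : h + l * l - (l + l) = ((v - l) + (v - l)) - (u - l) * (u + l).
    by rewrite {1}uv; ring.
  apply: (@dilate_le _ _ _ _ HB ((e / 4 + e / 4) + (e / 4 * (1 + 1)))); [lra|lra|lra|].
  have Hv : dilate B (e / 4) (v - l) by exact: NP.
  apply: (dilateB HB); [lra|lra| |].
    by apply: (dilateD HB) => //; lra.
  apply: (dilateM HB); first exact: NP.
  apply: (dilateD HB) => //; apply: (@dilate_le _ _ _ _ HB 2^-1); [lra|lra|lra|].
  exact: sqrt_iter_dilate.
exists (1 - l); first by rewrite (starB Hs) (star1 Hs) lstar.
have -> : h = l + l - l * l by apply/eqP; rewrite -subr_eq0 -lfix; apply/eqP; ring.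
by ring.
Qed.

End SquareRoot.

(** Hence 1 is an order unit for the cone of the elements [star y * y]. *)
Lemma hermitian_order_unit {R : realType} {A : locallyConvexComAlgType R[i]}
    (star : A -> A) (h : A) : is_BPstar_algebra star -> star h = h ->
  exists2 r : R, 0 < r & exists y, star y * y = 1 - r%:C *: h.
Proof.
move=> H hh; have Hs := bps_involution H.
have : [set: A] h by []; rewrite -(bps_cover H) => -[B HB Bh].
have [r r0 hr] := lin_span_dilate HB Bh.
have q0 : 0 < r^-1 / 2 by rewrite divr_gt0 // invr_gt0.
exists (r^-1 / 2) => //.
have [|||y ys yh] := exists_sqrt_one_sub Hs HB (h := (r^-1 / 2)%:C *: h).
- apply: (dilate_scale HB) hr; [lra| |exact: ltW].
  rewrite (normC_real (ltW q0)) -rmorphM /= lecR.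
  by rewrite mulrAC mulVf ?gt_eqF // div1r.
- by rewrite (starZ Hs) conjC_real hh.
- exact: (bps_complete H).
by exists y; rewrite ys.
Qed.

(** * Real states *)

Section RealStates.
Import ArrowAsProduct.
Context {R : realType} {A : locallyConvexComAlgType R[i]}.
Context (star : A -> A) (Hs : is_involution star).
Implicit Types (x y b : A) (r t : R) (G : A -> R).

(** Real parts of positive functionals.  They determine the functional, and with
    real values the states lie in a product of segments. *)
Record real_positive G : Prop := {
  rposD : forall x y, G (x + y) = G x + G y ;
  rposZ : forall r x, G (r%:C *: x) = r * G x ;
  rpos_star : forall x, G (star x) = G x ;
  rpos_ge0 : forall x, 0 <= G (star x * x)
}.

Definition real_state : set (A -> R) := [set G | real_positive G /\ G 1 = 1].

Lemma rposB G x y : real_positive G -> G (x - y) = G x - G y.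
Proof.
move=> PG; rewrite (rposD PG) -scaleN1r -[in LHS](rmorphN1 (@real_complex R)).
by rewrite (rposZ PG) mulN1r.
Qed.

Lemma rpos_cauchy_schwarz G x y : real_positive G ->
  G (star x * y) ^+ 2 <= G (star x * x) * G (star y * y).
Proof.
move=> PG; apply: discriminant_le => [|t]; first exact: (rpos_ge0 PG).
have ge0 := rpos_ge0 PG (x + t%:C *: y).
have swap : G (star y * x) = G (star x * y).
  by rewrite -(rpos_star PG) (starM Hs) (starK Hs).
rewrite (starD Hs) (starZ Hs) conjC_real mulrDl !mulrDr -!scalerAl -!scalerAr in ge0.
rewrite scalerA -rmorphM !(rposD PG) !(rposZ PG) swap in ge0.
by move: ge0; rewrite mulr2n expr2 !addrA.
Qed.

Lemma rpos_null G x y : real_positive G -> G (star x * x) <= 0 -> G (star x * y) = 0.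
Proof.
move=> PG G0; have {}G0 : G (star x * x) = 0.
  by apply/le_anti; rewrite G0 (rpos_ge0 PG).
have := rpos_cauchy_schwarz x y PG; rewrite G0 mul0r => H.
by apply/eqP; rewrite -sqrf_eq0; apply/eqP/le_anti; rewrite H sqr_ge0.
Qed.

Definition tilt G b : A -> R := fun y => G (star b * b * y) / G (star b * b).

Lemma real_state_tilt G b : 0 < G (star b * b) -> real_state G -> real_state (tilt G b).
Proof.
move=> Gb [PG G1]; split; last by rewrite /tilt mulr1 divff // gt_eqF.
split=> [x y|r x|x|x]; rewrite /tilt.
- by rewrite mulrDr (rposD PG) mulrDl.
- by rewrite -scalerAr (rposZ PG) mulrA.
- rewrite -(rpos_star PG (star b * b * x)).
  suff -> : star (star b * b * x) = star b * b * star x by [].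
  by rewrite !(starM Hs) (starK Hs); ring.
- have -> : star b * b * (star x * x) = star (b * x) * (b * x).
    by rewrite (starM Hs); ring.
  by rewrite divr_ge0 ?(rpos_ge0 PG).
Qed.

Definition tilt_stable (K : set (A -> R)) :=
  forall G b, K G -> 0 < G (star b * b) -> K (tilt G b).

(** At a maximum, tilting by [x] cannot increase the value at a = [star x * x], which
    says G(a^2) <= G(a)^2: the variance of a under G vanishes. *)
Lemma tilt_maximum_multiplicative (K : set (A -> R)) G x y :
  K `<=` real_state -> tilt_stable K -> K G ->
  (forall F, K F -> F (star x * x) <= G (star x * x)) ->
  G (star x * x * y) = G (star x * x) * G y.
Proof.
move=> KS Ktilt KG Gmax; have [PG G1] := KS _ KG.
set a := star x * x; have astar : star a = a by rewrite (starM Hs) (starK Hs).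
have [Ga0|Ga0] := eqVneq (G a) 0.
  by rewrite Ga0 mul0r -mulrA (rpos_null _ PG) // -/a Ga0.
have Ga : 0 < G a by rewrite lt0r Ga0 (rpos_ge0 PG).
have := Gmax _ (Ktilt _ _ KG Ga); rewrite -/a /tilt ler_pdivrMr // => Gaa.
(* G(c^2) is the variance of a. *)
pose c := a - (G a)%:C *: 1.
have cstar : star c = c.
  by rewrite /c (starB Hs) (starZ Hs) conjC_real (star1 Hs) astar.
have cc : G (star c * c) <= 0.
  rewrite cstar /c mulrBl !mulrBr -!scalerAl -!scalerAr !mul1r !mulr1.
  rewrite !(rposB _ _ PG) !(rposZ PG) G1; nra.
have := rpos_null y PG cc; rewrite cstar /c mulrBl -scalerAl mul1r.
by rewrite (rposB _ _ PG) (rposZ PG) => /eqP; rewrite subr_eq0 => /eqP.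
Qed.

Definition mult_at_square x : set (A -> R) :=
  [set G | forall y, G (star x * x * y) = G (star x * x) * G y].

Lemma continuous_eval x : continuous (fun G : A -> R => G x).
Proof. exact: proj_continuous. Qed.

Lemma closed_mult_at_square x : closed (mult_at_square x).
Proof.
apply: closed_forall => y; apply: closed_eq_fun; first exact: continuous_eval.
apply: (continuous_mul (u := fun G : A -> R => G _) (v := fun G : A -> R => G _));
    exact: continuous_eval.
Qed.

Lemma closed_real_state : closed real_state.
Proof.
have -> : real_state = [set G : A -> R | forall x y, G (x + y) = G x + G y] `&`
    [set G | forall r x, G (r%:C *: x) = r * G x] `&`
    [set G | forall x, G (star x) = G x] `&`
    [set G | forall x, 0 <= G (star x * x)] `&` [set G | G 1 = 1].
  by apply/seteqP; split=> [G [[]]|G [[[[]]]]].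
repeat apply: closedI.
- do 2! apply: closed_forall => ?; apply: closed_eq_fun; first exact: continuous_eval.
  apply: (continuous_add (u := fun G : A -> R => G _) (v := fun G : A -> R => G _));
    exact: continuous_eval.
- do 2! apply: closed_forall => ?; apply: closed_eq_fun; first exact: continuous_eval.
  apply: (continuous_mul (u := fun=> _) (v := fun G : A -> R => G _)).
    exact: cst_continuous.
  exact: continuous_eval.
- by apply: closed_forall => ?; apply: closed_eq_fun; exact: continuous_eval.
- apply: closed_forall => x; apply: (@preimage_closed _ _
    (fun G : A -> R => G (star x * x)) [set r | 0 <= r]).
    by move=> G _; exact: continuous_eval.
  exact: closed_ge.
- apply: (closed_eq_fun (v := fun=> 1)); [exact: continuous_eval|].
  exact: cst_continuous.
Qed.

(** A pointwise bound puts the states in a product of segments. *)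
Lemma compact_real_state :
  (forall x, exists c, forall G, real_state G -> `|G x| <= c) -> compact real_state.
Proof.
move=> /choice[c Hc].
have box_compact : compact [set G : A -> R | forall x, `[- c x, c x]%classic (G x)].
  exact: (@tychonoff A (fun=> R) (fun x => `[- c x, c x]%classic)
    (fun x => @segment_compact R _ _)).
apply: (subclosed_compact closed_real_state box_compact).
by move=> G SG x /=; rewrite in_itv /= -ler_norml Hc.
Qed.

(** The maximizers of the value at [star x * x] form the set [K'].  They remain stable
    under tilting because they are multiplicative at that element: the tilt by [b]
    does not change the value there. *)
Lemma exists_maximizers (K : set (A -> R)) x F :
  compact K -> K `<=` real_state -> tilt_stable K -> K F ->
  exists K', [/\ compact K', K' !=set0, tilt_stable K', K' `<=` K `&` mult_at_square x
    & forall G, K' G -> F (star x * x) <= G (star x * x)].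
Proof.
move=> Kc KS Kt KF.
have [|G /set_mem KG Gmax] := @compact_EVT_max _ _
  (fun G : A -> R => G (star x * x)) K (ex_intro _ F KF) Kc.
  by apply: continuous_subspaceT => G; exact: continuous_eval.
pose K' := K `&` [set H | H (star x * x) = G (star x * x)].
have K'm : K' `<=` mult_at_square x.
  move=> H [KH /= HG] y; apply: (tilt_maximum_multiplicative _ KS Kt KH) => F' KF'.
  by rewrite HG; apply/Gmax/mem_set.
exists K'; split.
- apply: compact_closedI => //; apply: (closed_eq_fun (v := fun=> _)).
    exact: continuous_eval.
  exact: cst_continuous.
- by exists G.
- move=> H b [KH /= HG] Hb; split; first exact: Kt.
  rewrite /= /tilt mulrC [star b * b * _]mulrC K'm // mulrCA.
  by rewrite mulVf ?mulr1 // gt_eqF.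
- by move=> H K'H; split; [case: K'H|exact: K'm].
by move=> H [_ /= ->]; apply/Gmax/mem_set.
Qed.

Lemma exists_mult_at_squares (K : set (A -> R)) (s : seq A) :
  compact K -> K `<=` real_state -> tilt_stable K -> K !=set0 ->
  exists G, K G /\ forall x, x \in s -> mult_at_square x G.
Proof.
elim: s K => [|x s IH] K Kc KS Kt [F KF]; first by exists F.
have [K' [K'c K'0 K't K'Km _]] := exists_maximizers x Kc KS Kt KF.
have K'K : K' `<=` K by move=> G /K'Km[].
have [G [K'G Gs]] := IH K' K'c (subset_trans K'K KS) K't K'0.
exists G; split; first exact: K'K.
by move=> y; rewrite inE => /predU1P[->|/Gs//]; have [] := K'Km _ K'G.
Qed.

(** The first maximization, at [x0], secures the lower bound; the conditions for
    all elements are closed and have the finite intersection property on the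
    maximizers. *)
Lemma exists_multiplicative_state F x0 : compact real_state -> real_state F ->
  exists G, [/\ real_state G, F (star x0 * x0) <= G (star x0 * x0) &
    forall x, mult_at_square x G].
Proof.
move=> Sc SF.
have [K [Kc K0 Kt KSm KF]] :=
  exists_maximizers x0 Sc (@subset_refl _ _)
    (fun G b SG Gb => real_state_tilt Gb SG) SF.
have KS : K `<=` real_state by move=> G /KSm[].
pose f x := K `&` mult_at_square x.
have fip : finI setT f.
  move=> D _; have [G [KG GD]] :=
    exists_mult_at_squares (finmap.enum_fset D) Kc KS Kt K0.
  by exists G => x /= xD; split=> //; apply: GD.
have [|G [KG Gcl]] := Kc _ (finI_filter fip).
  by exists (f 0) => [|? []//]; exact: finI_from1.
exists G; split; [exact: KS|exact: KF|move=> x].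
apply: closed_mult_at_square => // C GC; apply: Gcl => //.
by exists (f x) => [|? []//]; exact: finI_from1.
Qed.
End RealStates.

(** * From real states to characters *)

Section Complexify.
Context {R : realType} {A : locallyConvexComAlgType R[i]}.
Context (star : A -> A) (Hs : is_involution star).
Implicit Types (x y : A) (G : A -> R).

Lemma scale_ReIm (z : R[i]) x :
  z *: x = (complex.Re z)%:C *: x + (complex.Im z)%:C *: ('i *: x).
Proof. by rewrite scalerA -scalerDl mulrC -complexE. Qed.

Definition complexify G x : R[i] := (G x) -i* (G ('i *: x)).

Lemma scale_ii x : 'i *: ('i *: x) = - x :> A.
Proof. by rewrite scalerA -expr2 sqr_i scaleN1r. Qed.

Lemma complexify_linear G : real_positive star G ->
  linear_for *%R (complexify G : A -> R[i]).
Proof.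
move=> PG z x y; rewrite /complexify scalerDr scalerA [_ * z]mulrC -scalerA.
rewrite !(rposD PG) !(scale_ReIm z) !(rposD PG) !(rposZ PG) scale_ii.
have -> : G (- x) = - G x.
  by rewrite -[- x]sub0r (rposB _ _ PG) -(scale0r x) (rposZ PG 0) mul0r sub0r.
case: z => a b; apply/eqP; rewrite eq_complex /=; apply/andP; split; apply/eqP; ring.
Qed.

Lemma exists_complexify G : real_positive star G ->
  exists phi : {scalar A}, forall x, phi x = complexify G x.
Proof.
move=> PG.
pose phi : {scalar A} := HB.pack_for {scalar A} (complexify G)
  (GRing.isLinear.Build _ _ _ _ (complexify G) (complexify_linear PG)).
by exists phi.
Qed.

(** The symmetry under [star] comes from the reality of f at (x + 1)^* (x + 1), used for
    x and for i x. *)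
Lemma real_positive_Re (f : {scalar A}) : positive_functional star f ->
  real_positive star (fun x => complex.Re (f x)).
Proof.
move=> Pf; split.
- by move=> x y; rewrite linearD; case: (f x) (f y) => [? ?] [].
- by move=> r x; rewrite linearZ /=; case: (f x) => a b /=; rewrite mul0r subr0.
- move=> x; have H y : complex.Im (f (star y * y)) = 0.
    by have := Pf y; rewrite lecE => /andP[/eqP].
  have Im_star y : complex.Im (f (star y)) + complex.Im (f y) = 0.
    have := H (y + 1); rewrite (starD Hs) (star1 Hs) mulrDl !mulrDr !mul1r mulr1.
    have := H 1; rewrite (star1 Hs) mulr1 => H1.
    by rewrite !raddfD /= H H1 add0r addr0.
  have := Im_star ('i *: x); rewrite (starZ Hs) !linearZ /=.
  case: (f (star x)) (f x) => a b [c d] /=.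
  rewrite !mul0r !mul1r mulN1r => H'; lra.
- by move=> x; have := Pf x; rewrite lecE => /andP[].
Qed.

(** By polarization, 4 h = (h + 1)^2 - (h - 1)^2. *)
Lemma mult_hermitian G h y :
  real_positive star G -> (forall x, mult_at_square star x G) -> star h = h ->
  G (h * y) = G h * G y.
Proof.
move=> PG mG hh.
have sq z : star z = z -> G (z * z * y) = G (z * z) * G y.
  by move=> zz; have := mG z y; rewrite zz.
have Hp := sq (h + 1); have Hm := sq (h - 1).
rewrite (starD Hs) (starB Hs) hh (star1 Hs) in Hp Hm.
have quad z : h * z *+ 4 = (h + 1) * (h + 1) * z - (h - 1) * (h - 1) * z by ring.
have G4 z : G (z *+ 4) = G z * 4 by rewrite !mulrS mulr0n addr0 !(rposD PG); ring.
have : G (h * y) * 4 = G h * G y * 4.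
  rewrite -G4 quad (rposB _ _ PG) Hp // Hm // -mulrBl -(rposB _ _ PG).
  have -> : (h + 1) * (h + 1) - (h - 1) * (h - 1) = h *+ 4 by ring.
  by rewrite G4; ring.
by move/mulIf; apply; rewrite pnatr_eq0.
Qed.

(** Multiplicativity passes from hermitian elements to all elements through
    2 x = h + i k with h and k hermitian. *)
Lemma exists_character G : real_state star G -> (forall x, mult_at_square star x G) ->
  exists2 phi : {scalar A}, Ms star phi & forall x, complex.Re (phi x) = G x.
Proof.
move=> [PG G1] mG; have [phi phiE] := exists_complexify PG.
have G_istar x : G ('i *: star x) = - G ('i *: x).
  apply/eqP; rewrite -addr_eq0 -(rpos_star PG ('i *: x)) (starZ Hs).
  rewrite -(rposD PG) -scalerDl.
  by rewrite conjC_i subrr -[0]/(0%:C) (rposZ PG) mul0r.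
have phi_herm h y : star h = h -> phi (h * y) = phi h * phi y.
  move=> hh; rewrite !phiE /complexify scalerAr !(mult_hermitian _ PG mG hh).
  have -> : G ('i *: h) = 0 by have := G_istar h; rewrite hh => ?; lra.
  by apply/eqP; rewrite eq_complex /= oppr0 !mul0r subr0 addr0 mulrN !eqxx.
exists phi; last by move=> x; rewrite phiE.
split.
- exists 1; rewrite phiE /complexify G1; apply/eqP => /(congr1 (@complex.Re _)) /= /eqP.
  by rewrite oner_eq0.
- move=> x; rewrite !phiE /complexify (rpos_star PG) G_istar.
  by apply/eqP; rewrite eq_complex /= !eqxx.
move=> x y; pose h := x + star x; pose k := 'i *: (star x - x).
have hh : star h = h by rewrite /h (starD Hs) (starK Hs) addrC.
have kk : star k = k.
  rewrite /k (starZ Hs) (starB Hs) (starK Hs) conjC_i scaleNr -scalerN opprB.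
  by [].
have x2 : x *+ 2 = h + 'i *: k by rewrite /k scale_ii /h; ring.
have : phi (x *+ 2 * y) = phi (x *+ 2) * phi y.
  clearbody h k; rewrite x2 mulrDl -scalerAl !linearD !linearZ /= !phi_herm //.
  by rewrite mulrDl mulrA.
by rewrite mulrnAl !raddfMn mulrnAl => /eqP; rewrite eqrMn2r => /eqP.
Qed.

Lemma real_state_hermitian_le h : is_BPstar_algebra star -> star h = h ->
  exists c, forall G, real_state star G -> G h <= c.
Proof.
move=> HA hh; have [r r0 [y yh]] := hermitian_order_unit HA hh.
exists r^-1 => F [PF F1]; have := rpos_ge0 PF y.
rewrite yh (rposB _ _ PF) F1 (rposZ PF) subr_ge0 => Fh.
by rewrite -[r^-1]mul1r ler_pdivlMr // mulrC.
Qed.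

End Complexify.

(** * Positive functionals are dominated by characters *)

Lemma real_state_bounded {R : realType} {A : locallyConvexComAlgType R[i]}
    (star : A -> A) (x : A) : is_BPstar_algebra star ->
  exists c, forall G, real_state star G -> `|G x| <= c.
Proof.
move=> HA; have Hs := bps_involution HA.
have hh : star (x + star x) = x + star x by rewrite (starD Hs) (starK Hs) addrC.
have [c cP] := real_state_hermitian_le HA hh.
have [d dP] : exists d, forall G, real_state star G -> G (- (x + star x)) <= d.
  by apply: real_state_hermitian_le => //; rewrite (starN Hs) hh.
exists (`|c| + `|d|) => G SG; have [PG _] := SG.
have := cP _ SG; have := dP _ SG.
rewrite -[- (x + _)]sub0r (rposB _ _ PG) (rposD PG) (rpos_star PG).
have -> : G 0 = 0 by rewrite -(scale0r x) (rposZ PG 0) mul0r.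
have := ler_norm c; have := ler_norm d; have := normr_ge0 c; have := normr_ge0 d.
by rewrite ler_norml; lra.
Qed.

(** The factor 2 comes from bounding the real and the imaginary part separately.
    Quantifying over the bound [r] instead of producing one character also
    covers f(1) = 0, where [Ms] might be empty. *)
Lemma positive_functional_le {R : realType} {A : locallyConvexComAlgType R[i]}
    (star : A -> A) (f : {scalar A}) (x : A) (r : R) :
  is_BPstar_algebra star -> positive_functional star f -> 0 <= r ->
  (forall phi, Ms star phi -> `|phi x| <= r%:C) ->
  `|f x| <= (complex.Re (f 1) * r *+ 2)%:C.
Proof.
move=> HA Pf r0 Hr; have Hs := bps_involution HA.
have PF := real_positive_Re Hs Pf.
pose F y := complex.Re (f y).
have F10 : 0 <= F 1 by have := rpos_ge0 PF 1; rewrite (star1 Hs) mulr1.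
have schwarz y : F y ^+ 2 <= F 1 * F (star y * y).
  have := rpos_cauchy_schwarz Hs 1 y PF.
  by rewrite (star1 Hs) mulr1 mul1r.
have Fxx : F (star x * x) <= F 1 * r ^+ 2.
  have [F1|F1] := eqVneq (F 1) 0.
    have := rpos_null Hs (x := 1) (star x * x) PF.
    rewrite (star1 Hs) !mul1r -/(F 1) -/(F (star x * x)) F1 mul0r.
    by move=> -> //.
  have F1gt : 0 < F 1 by rewrite lt0r F1.
  pose S y := F y / F 1.
  have SS : real_state star S.
    split; last by rewrite /S divff.
    split=> [y z|t y|y|y]; rewrite /S.
    - by rewrite /F (rposD PF) mulrDl.
    - by rewrite /F (rposZ PF) mulrA.
    - by rewrite /F (rpos_star PF).
    - by rewrite divr_ge0 // (rpos_ge0 PF).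
  have [G [SG SGx mG]] := exists_multiplicative_state Hs x
    (compact_real_state (fun y => real_state_bounded y HA)) SS.
  have [phi Mphi phiG] := exists_character Hs SG mG.
  rewrite [F 1 * _]mulrC -ler_pdivrMr //; apply: (le_trans SGx).
  have [_ phiH phiM] := Mphi.
  rewrite -phiG phiM phiH mulrC -normCK.
  have : `|phi x| ^+ 2 <= (r ^+ 2)%:C.
    rewrite rmorphXn /=; apply: lerXn2r; rewrite ?nnegrE //; last exact: Hr.
    by rewrite ler0c.
  by rewrite lecE => /andP[].
(* Applied to x and to i x, which have the same x^* x. *)
have bound y : star y * y = star x * x -> `|F y| <= F 1 * r.
  move=> yx; rewrite -(@ler_pXn2r _ 2) ?nnegrE ?mulr_ge0 //.
  rewrite real_normK ?num_real // exprMn expr2 -mulrA.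
  by apply: le_trans (schwarz y) _; rewrite yx ler_wpM2l.
have Fx : `|complex.Re (f x)| <= F 1 * r by exact: bound.
have Fix : `|complex.Im (f x)| <= F 1 * r.
  have -> : complex.Im (f x) = - F ('i *: x).
    by rewrite /F linearZ /=; case: (f x) => a b /=; rewrite mul0r mul1r sub0r opprK.
  rewrite normrN; apply: bound.
  rewrite (starZ Hs) conjC_i -scalerAl -scalerAr scalerA mulNr -expr2 sqr_i.
  by rewrite opprK scale1r.
rewrite [f x]complexE; apply: le_trans (ler_normD _ _) _.
have ni : `|'i : R[i]| = 1 by rewrite normc_def /= expr0n expr1n add0r sqrtr1.
rewrite normrM ni mul1r.
have nR (a : R) : `|a%:C| = `|a|%:C by rewrite normc_def /= expr0n addr0 sqrtr_sqr.
by rewrite !nR -rmorphD lecR mulr2n lerD.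
Qed.

(* The regular module R[i]^o carries the usual topology of the complex plane. *)
Theorem corollary6 (R : realType) (A : locallyConvexComAlgType R[i])
    (star : A -> A) :
  is_BPstar_algebra star ->
  equicontinuous (Ms star) (fun (phi : {scalar A}) (x : A) => phi x : R[i]^o) ->
  forall f : {scalar A}, positive_functional star f ->
    continuous (fun x : A => f x : R[i]^o).
Proof.
move=> HA equi f Pf x; have Hs := bps_involution HA.
have F10 : 0 <= complex.Re (f 1).
  by have := rpos_ge0 (real_positive_Re Hs Pf) 1; rewrite (star1 Hs) mulr1.
apply/cvgrPdist_lt => e; rewrite ltcE => /andP[/eqP Ime e0].
have -> : e = (complex.Re e)%:C by move: e Ime {e0} => [a b] /= ->.
set F1 := complex.Re (f 1) in F10; set q := complex.Re e.
(* The summand 1 keeps the denominator positive when f(1) = 0. *)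
have d0 : 0 < F1 *+ 2 + 1 by rewrite ltr_wpDl // mulrn_wge0.
pose r := q / (F1 *+ 2 + 1).
have r0 : 0 < r by rewrite divr_gt0.
have ent : entourage [set p : R[i]^o * R[i]^o | ball p.1 (r%:C) p.2].
  by rewrite -entourage_from_ballE; exists r%:C => //=; rewrite ltcR.
apply: filterS (equi x _ ent) => y near_y.
have Mxy phi : Ms star phi -> `|phi (x - y)| <= r%:C.
  by move=> /near_y phi_near; rewrite linearB ltW.
rewrite -linearB; apply: le_lt_trans (positive_functional_le HA Pf (ltW r0) Mxy) _.
rewrite ltcR /r -mulrnAl mulrA ltr_pdivrMr // mulrC ltr_pM2l //.
by rewrite ltrDl.
Qed.
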